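(* Let $n$ be a positive integer and let $G=K_n\times K_2$. Then $\mathcal{E}(G)=2\tau(G)$.
   Context: All graphs are finite, simple and undirected. The energy $\mathcal{E}(G)$ is the sum of the absolute values of all eigenvalues (with multiplicity) of the adjacency matrix $A(G)$. The vertex cover number $\tau(G)$ is the minimum cardinality of a set $X\subseteq V(G)$ such that every edge of $G$ has at least one endpoint in $X$. $K_n$ is the complete graph on $n$ vertices. Here $G\times H$ denotes the Cartesian product: the graph with vertex set $V(G)\times V(H)$ in which $(g_1,h_1)\sim(g_2,h_2)$ if and only if either $g_1=g_2$ and $h_1\sim h_2$, or $g_1\sim g_2$ and $h_1=h_2$. *)

(* Defs.v *)
From HB Require Import structures.
From mathcomp Require Import all_boot all_order all_algebra.

Set Implicit Arguments.
Unset Strict Implicit.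
Unset Printing Implicit Defensive.

Import Order.TTheory GRing.Theory Num.Theory.
Local Open Scope ring_scope.

Record sgraph := SGraph {
  vertex :> finType;
  adj : rel vertex;
  adj_sym : symmetric adj;
  adj_irrefl : irreflexive adj
}.

Definition complete_adj (n : nat) : rel 'I_n := fun i j => i != j.

Lemma complete_adj_sym n : symmetric (@complete_adj n).
Proof. by move=> i j; rewrite /complete_adj eq_sym. Qed.

Lemma complete_adj_irrefl n : irreflexive (@complete_adj n).
Proof. by move=> i; rewrite /complete_adj eqxx. Qed.

Definition complete_graph (n : nat) : sgraph :=
  SGraph (@complete_adj_sym n) (@complete_adj_irrefl n).

Section CartesianProduct.
Variables G H : sgraph.

Definition cartesian_adj : rel (G * H)%type := fun u v =>
  ((u.1 == v.1) && adj u.2 v.2) || (adj u.1 v.1 && (u.2 == v.2)).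

Lemma cartesian_adj_sym : symmetric cartesian_adj.
Proof.
move=> u v; rewrite /cartesian_adj (eq_sym u.1) (eq_sym u.2).
by rewrite (@adj_sym G u.1) (@adj_sym H u.2).
Qed.

Lemma cartesian_adj_irrefl : irreflexive cartesian_adj.
Proof. by move=> u; rewrite /cartesian_adj !adj_irrefl andbF. Qed.

Definition cartesian_product : sgraph :=
  SGraph cartesian_adj_sym cartesian_adj_irrefl.

End CartesianProduct.

Definition vertex_cover (G : sgraph) (X : {set G}) : bool :=
  [forall x, forall y, adj x y ==> (x \in X) || (y \in X)].

Lemma vertex_coverT (G : sgraph) : vertex_cover [set: G].
Proof. by apply/'forall_forallP=> x y; rewrite inE implybT. Qed.

(* [arg min] is meaningful because its seed [set: G] is a vertex cover, by
   [vertex_coverT]. *)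
Definition vertex_cover_number (G : sgraph) : nat :=
  #|[arg min_(X < [set: G] | vertex_cover X) #|X| ]|.

Lemma vertex_cover_numberP (G : sgraph) :
  (exists2 X : {set G}, vertex_cover X & #|X| = vertex_cover_number G) /\
  (forall X : {set G}, vertex_cover X -> (vertex_cover_number G <= #|X|)%N).
Proof.
rewrite /vertex_cover_number; case: arg_minnP => [|X Xcov Xmin].
  exact: vertex_coverT.
by split; [exists X | exact: Xmin].
Qed.

(* The eigenvalues are taken in an arbitrary algebraically closed field with a
   norm, such as [algC] or [R[i]]; no choice of such a field affects the
   (totally real algebraic) spectrum of a graph. *)
Section Energy.
Variable C : numClosedFieldType.

Definition adjacency_mx (G : sgraph) : 'M[C]_#|G| :=
  \matrix_(i, j) (adj (enum_val i) (enum_val j))%:R.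

(* The roots of the characteristic polynomial, listed with multiplicity. *)
Definition spectrum (m : nat) (A : 'M[C]_m) : seq C :=
  sval (closed_field_poly_normal (char_poly A)).

Lemma spectrumP (m : nat) (A : 'M[C]_m) :
  char_poly A = \prod_(z <- spectrum A) ('X - z%:P).
Proof.
rewrite /spectrum; case: closed_field_poly_normal => r /= {1}->.
by rewrite (monicP (char_poly_monic A)) scale1r.
Qed.

Definition energy (G : sgraph) : C :=
  \sum_(z <- spectrum (adjacency_mx G)) `|z|.

End Energy.

(* Main.v *)
(* In block form, with one block per copy of K_n, the adjacency matrix is
   [[J - I, I], [I, J - I]], so its characteristic polynomial is
   det (x I - J) det ((x + 2) I - J) = (x - n) x^(n-1) (x + 2 - n) (x + 2)^(n-1)
   and the energy is n + |n - 2| + 2 (n - 1). The complement of a vertex cover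
   is independent, hence has at most one vertex in each copy of K_n; for n > 1
   there is an independent set of size 2, so the vertex cover number is
   2 n - 2, while it is 1 for n = 1. *)
Require Import Defs.
From mathcomp Require Import all_boot all_order all_algebra.
From mathcomp Require Import ring zify.

Set Implicit Arguments.
Unset Strict Implicit.
Unset Printing Implicit Defensive.

Import Order.TTheory GRing.Theory Num.Theory.

Local Open Scope ring_scope.

(* Conjugating M = a I - J by the unitriangular N makes it the block triangular T;
   written as M N = N T, this needs no inverse of N. *)
Lemma det_scalar_sub_const1 (R : comNzRingType) (a : R) (m : nat) :
  \det (a%:M - const_mx 1 : 'M_m.+1) = (a - m.+1%:R) * a ^+ m.
Proof.
pose J p q : 'M[R]_(p, q) := const_mx 1.
have mulJJ p q r : J p q *m J q r = q%:R *: J p r.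
  apply/matrixP=> i j; rewrite !mxE (eq_bigr (fun=> 1)); last first.
    by move=> k _; rewrite !mxE mulr1.
  by rewrite sumr_const card_ord mulr1.
pose N : 'M_(1 + m) := block_mx 1%:M 0 (J m 1) 1%:M.
pose T : 'M_(1 + m) := block_mx (a - m.+1%:R)%:M (- J 1 m) 0 a%:M.
have J11 : J 1 1 = 1%:M by apply/matrixP=> i j; rewrite !mxE !ord1.
have defM : (a%:M - const_mx 1 : 'M_(1 + m)) *m N = N *m T.
  rewrite /N /T (scalar_mx_block 1 m) -[const_mx 1]block_mx_const.
  rewrite opp_block_mx add_block_mx !mulmx_block.
  rewrite -!/(J _ _) !mulmx1 !mulmx0 !mul1mx !(mulmxDl, mulNmx, mulmxN) !mulJJ J11.
  rewrite ?mul_mx_scalar ?mul_scalar_mx ?mul0mx ?mulmx0.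
  congr block_mx; apply/matrixP=> i j; rewrite !mxE ?ord1 ?eqxx; ring.
have detN : \det N = 1 by rewrite det_lblock !det1 mulr1.
have := congr1 determinant defM.
by rewrite !det_mulmx detN mulr1 mul1r det_ublock !det_scalar expr1.
Qed.

(** Conjugation by the unitriangular [N] makes the matrix block triangular; written as a product
    identity, this needs neither [N^-1] nor commuting blocks. *)
Lemma det_block_mx_sym (R : comNzRingType) (n : nat) (P Q : 'M[R]_n) :
  \det (block_mx P Q Q P) = \det (P + Q) * \det (P - Q).
Proof.
pose N : 'M[R]_(n + n) := block_mx 1%:M 0 1%:M 1%:M.
have defM : block_mx P Q Q P *m N = N *m block_mx (P + Q) Q 0 (P - Q).
  rewrite !mulmx_block !mulmx1 !mulmx0 !mul1mx !mul0mx !add0r !addr0.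
  by rewrite [Q + P]addrC [Q + (P - Q)]addrC subrK.
have detN : \det N = 1 by rewrite det_lblock !det1 mulr1.
have := congr1 determinant defM.
by rewrite !det_mulmx detN mulr1 mul1r det_ublock.
Qed.

(** Once [m] and [n] are identified, [f] is a permutation, acting on both rows and columns, so its
    sign occurs twice and cancels. *)
Lemma char_poly_mxsub_inj (R : comNzRingType) (m n : nat) (f : 'I_m -> 'I_n)
    (A : 'M[R]_n) :
  m = n -> injective f -> char_poly (mxsub f f A) = char_poly A.
Proof.
move=> eq_mn f_inj; subst m; rewrite /char_poly.
have -> : char_poly_mx (mxsub f f A) =
    row_perm (perm.perm f_inj) (col_perm (perm.perm f_inj) (char_poly_mx A)).
  by apply/matrixP=> i j; rewrite !mxE !perm.permE (inj_eq f_inj).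
rewrite row_permE col_permE !det_mulmx !det_perm perm.odd_permV.
by rewrite mulrCA -signr_addb addbb mulr1.
Qed.

(** A factorization into monic linear factors is unique up to order, and the sum ignores the
    order. *)
Lemma energy_char_poly (C : numClosedFieldType) (G : sgraph) (s : seq C) :
  char_poly (adjacency_mx C G) = \prod_(z <- s) ('X - z%:P) ->
  energy C G = \sum_(z <- s) `|z|.
Proof. by rewrite spectrumP => /prod_XsubC_eq; apply: perm_big. Qed.

Definition prism (n : nat) : sgraph :=
  cartesian_product (complete_graph n) (complete_graph 2).

(** Listing one copy of [K_n] after the other gives the adjacency matrix its 2 by 2 block form. *)
Definition layer_vertex (n : nat) (i : 'I_(n + n)) : prism n :=
  match split i with inl j => (j, ord0) | inr j => (j, ord_max) end.

Lemma layer_vertex_inj n : injective (@layer_vertex n).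
Proof.
apply: (can_inj (g := fun u : prism n =>
  unsplit (if u.2 == ord0 then inl u.1 else inr u.1))).
by move=> i; rewrite /layer_vertex -[RHS]splitK; case: (split i).
Qed.

Lemma card_prism n : #|prism n| = (n + n)%N.
Proof. by rewrite card_prod !card_ord muln2 addnn. Qed.

Lemma char_poly_prism (C : numClosedFieldType) (m : nat) :
  char_poly (adjacency_mx C (prism m.+1)) =
  ('X - m.+1%:R) * 'X ^+ m * (('X + 2 - m.+1%:R) * ('X + 2) ^+ m).
Proof.
pose f (i : 'I_(m.+1 + m.+1)) : 'I_#|prism m.+1| := enum_rank (layer_vertex i).
have f_inj : injective f by apply: inj_comp enum_rank_inj (@layer_vertex_inj _).
rewrite -(char_poly_mxsub_inj _ (esym (card_prism _)) f_inj) /char_poly.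
(* The diagonal block is ['X I - (J - I)], with [J] the all-ones matrix. *)
pose P : 'M[{poly C}]_m.+1 := ('X + 1)%:M - const_mx 1.
have -> : char_poly_mx (mxsub f f (adjacency_mx C (prism m.+1))) =
    block_mx P (- 1%:M) (- 1%:M) P.
  apply/matrixP=> i j; rewrite -[i]splitK -[j]splitK.
  case: (split i) => i'; case: (split j) => j' /=;
    rewrite ?block_mxEul ?block_mxEur ?block_mxEdl ?block_mxEdr !mxE
      !enum_rankK /layer_vertex ?(unsplitK (inl _)) ?(unsplitK (inr _))
      ?(eq_lshift, eq_rshift, eq_lrshift, eq_rlshift) /=
      /cartesian_adj /= /complete_adj /= ?eqxx ?andbF ?andbT ?orbF;
    case: (i' == j') => /=; rewrite ?polyC1 ?polyC0 ?mulr0n ?mulr1n; ring.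
rewrite det_block_mx_sym.
have -> : P + - 1%:M = 'X%:M - const_mx 1.
  by rewrite /P raddfD /= addrAC addrK.
have -> : P - - 1%:M = ('X + 2)%:M - const_mx 1.
  by rewrite /P opprK addrAC -raddfD /= -addrA.
by rewrite !det_scalar_sub_const1.
Qed.

Lemma energy_prism (C : numClosedFieldType) (m : nat) :
  energy C (prism m.+1) = m.+1%:R + `|m.+1%:R - 2| + m%:R * 2.
Proof.
pose s : seq C := m.+1%:R :: m.+1%:R - 2 :: nseq m 0 ++ nseq m (- 2).
rewrite (@energy_char_poly _ _ s); last first.
  rewrite char_poly_prism !big_cons big_cat !big_nseq !iter_mulr_1 /=.
  rewrite !rmorphB !rmorphN !rmorph_nat rmorph0 subr0 opprK; ring.
rewrite !big_cons big_cat !big_nseq !iter_addr_0 /=.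
by rewrite normrN normr0 mul0rn add0r !normr_nat addrA mulr_natl.
Qed.

Lemma vertex_cover_prism_lb n (X : {set prism n}) :
  vertex_cover X -> (n + n - 2 <= #|X|)%N.
Proof.
move=> /'forall_forallP coverX.
suff: (#|~: X| <= 2)%N by have := cardsC X; rewrite card_prism; lia.
rewrite -[leqRHS](card_ord 2).
(* Two distinct uncovered vertices in one layer would span an uncovered edge, so the layer index is
   injective on the complement of [X]. *)
apply: (@leq_card_in _ _ (fun u : prism n => u.2)) => u v.
rewrite !inE => /negbTE uX /negbTE vX eq2.
have := coverX u v; rewrite uX vX orbF implybF /= /cartesian_adj /=.
rewrite /complete_adj eq2 eqxx /= andbF andbT negbK => /eqP eq1.
by rewrite [u]surjective_pairing [v]surjective_pairing eq1 eq2.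
Qed.

Lemma vertex_cover_number_prism1 : vertex_cover_number (prism 1) = 1%N.
Proof.
have [[X coverX <-] min_tau] := vertex_cover_numberP (prism 1).
apply/eqP; rewrite eqn_leq; apply/andP; split.
  apply: leq_trans (min_tau [set (ord0, ord0)] _) _; last by rewrite cards1.
  apply/'forall_forallP=> -[i a] [j b]; rewrite !inE /= /cartesian_adj /=.
  rewrite !xpair_eqE !ord1 /= /complete_adj /= orbF.
  by case: a b => [[|[|a]] ?] [[|[|b]] ?].
rewrite card_gt0; apply: contraTneq coverX => ->.
(* The graph has a single edge, which the empty set misses. *)
apply/forallPn; exists (ord0, ord0); apply/forallPn; exists (ord0, ord_max).
by rewrite !inE.
Qed.

Lemma vertex_cover_number_prism m :
  vertex_cover_number (prism m.+2) = m.+1.*2.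
Proof.
have [[X coverX defX] min_tau] := vertex_cover_numberP (prism m.+2).
apply/eqP; rewrite eqn_leq; apply/andP; split; last first.
  by rewrite -defX; apply: leq_trans (vertex_cover_prism_lb coverX); lia.
(* [a] and [b] differ in both coordinates, hence are not adjacent; this uses that [K_n] has at least
   two vertices. *)
pose a : prism m.+2 := (ord0, ord0).
pose b : prism m.+2 := (ord_max, ord_max).
have neq_ab : a != b by [].
have := min_tau (~: [set a; b]).
have := cardsC [set a; b]; rewrite card_prism cards2 neq_ab /= => cardE.
move=> /(_ _)/leq_trans->//; last by lia.
apply/'forall_forallP=> u v; apply/implyP.
rewrite !inE; apply: contraLR; rewrite negb_or !negbK.
by case/andP=> /orP[]/eqP-> /orP[]/eqP->;
  rewrite /= /cartesian_adj /= /complete_adj ?eqxx.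
Qed.

Theorem theorem3p7 (C : numClosedFieldType) (n : nat) (n_gt0 : (0 < n)%N) :
  let G := cartesian_product (complete_graph n) (complete_graph 2) in
  energy C G = 2%:R * (vertex_cover_number G)%:R.
Proof.
move=> G; rewrite {}/G -/(prism n).
(* For [n = 1] both sides are 2; for [n = m + 2] the absolute value is [m] and both sides are
   [4 (m + 1)]. *)
case: n n_gt0 => // -[_|m _]; rewrite energy_prism.
  rewrite vertex_cover_number_prism1 distrC ger0_norm ?subr_ge0 ?ler1n //.
  by ring.
rewrite vertex_cover_number_prism ger0_norm ?subr_ge0 ?ler_nat //.
by rewrite -muln2; ring.
Qed.
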